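(* Let $V$ be a complex-valued function on $[-1,1]$ extending holomorphically to a domain $D\subset\mathbb{C}$ containing $[-1,1]$, let $\beta\in(-1,1)$, $\delta\ge0$, assume hypotheses (H1) and (H3) described in the context, and let $Y$ be a primitive of $V$. Fix a sign $\sigma\in\{+1,-1\}$. For every fixed real $a$ large enough, the equation $$\mathrm{Re}\int_{\sigma}^{\beta}\sqrt{V(x)+i\sigma\delta-a-ib}\,dx=0$$ in the unknown $b\in\mathbb{R}$ has a unique solution $b=b(a)$, and this solution satisfies $$b(a)=\frac{1}{\beta-\sigma}\,\mathrm{Im}\,(Y(\beta)-Y(\sigma))+\sigma\delta+\mathcal{O}\Big(\frac1a\Big)\qquad(a\to+\infty).$$
   Context: Square roots in the integrals are continuous branches on the interval of integration (the equation does not depend on the sign). A turning point (for $E\in\mathbb{C}$) is a zero of $V-E$. The Stokes line starting from $x$ is $\{y:\mathrm{Re}\int_x^y(V(t)-E)^{1/2}dt=0\}$; Stokes lines are integral curves of the vector field $s(x)=i\,\overline{(V(x)-E)^{1/2}}$. (H1) For any $\Omega\subset\mathbb{C}$, if $V^{-1}(\Omega)$ is bounded then $\Omega$ is relatively compact. (H3) If $E$ is large enough with small imaginary part (i.e. there are $R_0,\varepsilon_0>0$ such that for all $E$ with $|E|\ge R_0$, $|\mathrm{Im}\,E|\le\varepsilon_0|E|$), then $1$, $-1$ and $\beta$ belong to the same Stokes region: there are paths from $-1$ to $\beta$ and from $1$ to $\beta$ that do not intersect the Stokes lines issuing from the turning points. *)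

(* Defs.v *)
(* Stdlib reals with Coquelicot. *)
From Stdlib Require Import Reals List.
From Coquelicot Require Import Coquelicot.
Open Scope R_scope.

Definition segment (a b x : R) : Prop := Rmin a b <= x <= Rmax a b.

(* One-sided at the end points of the segment. *)
Definition is_derive_on (a b : R) (f df : R -> C) : Prop :=
  forall x : R, segment a b x ->
    filterdiff (K := R_AbsRing) (U := R_NormedModule) (V := C_R_NormedModule)
      f (within (segment a b) (locally x)) (fun h => scal h (df x)).

Definition connected (D : C -> Prop) : Prop :=
  forall A B : C -> Prop, open A -> open B ->
    (forall z, D z -> A z \/ B z) ->
    (exists z, D z /\ A z) -> (exists z, D z /\ B z) ->
    exists z, D z /\ A z /\ B z.

Definition complex_domain (D : C -> Prop) : Prop :=
  (exists z, D z) /\ open D /\ connected D.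

Definition holomorphic_on (D : C -> Prop) (f : C -> C) : Prop :=
  forall z, D z -> ex_derive (K := C_AbsRing) (V := C_NormedModule) f z.

Definition bounded_set (A : C -> Prop) : Prop :=
  exists M : R, forall z, A z -> Cmod z <= M.

Definition compact_set (A : C -> Prop) : Prop :=
  forall F : (C -> Prop) -> Prop,
    (forall U, F U -> open U) ->
    (forall z, A z -> exists U, F U /\ U z) ->
    exists l : list (C -> Prop),
      (forall U, In U l -> F U) /\ (forall z, A z -> exists U, In U l /\ U z).

Definition closure (A : C -> Prop) (z : C) : Prop :=
  forall U : C -> Prop, locally z U -> exists w, U w /\ A w.

Definition relatively_compact (A : C -> Prop) : Prop := compact_set (closure A).

(* V is only meaningful on D: values of V outside D never matter, so the
   preimage is taken inside D. *)
Definition H1 (D : C -> Prop) (V : C -> C) : Prop :=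
  forall Omega : C -> Prop,
    bounded_set (fun z => D z /\ Omega (V z)) -> relatively_compact Omega.

Definition sqrt_branch (a b : R) (f g : R -> C) : Prop :=
  continuous_on (segment a b) g /\
  forall t, segment a b t -> (g t * g t)%C = f t.

Definition turning_point (D : C -> Prop) (V : C -> C) (E x : C) : Prop :=
  D x /\ V x = E.

(* The set {y : Re int_x^y (V - E)^(1/2) = 0}.  The integral is multivalued, so
   it is taken along the line itself: Re int_x^z = 0 for every z met between x
   and y.  Equivalently gamma moves along the integral curves of
   i * conj ((V - E)^(1/2)) coming out of x.  A C^1 path may stop, hence have
   corners, and g may switch sign where V - E vanishes. *)
Definition stokes_line (D : C -> Prop) (V : C -> C) (E x y : C) : Prop :=
  exists gamma dgamma g : R -> C,
    gamma 0 = x /\ gamma 1 = y /\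
    (forall t, segment 0 1 t -> D (gamma t)) /\
    is_derive_on 0 1 gamma dgamma /\
    continuous_on (segment 0 1) dgamma /\
    sqrt_branch 0 1 (fun t => (V (gamma t) - E)%C) g /\
    forall s, segment 0 1 s ->
      Re (RInt (V := C_R_CompleteNormedModule)
            (fun t => (g t * dgamma t)%C) 0 s) = 0.

Definition same_stokes_region (D : C -> Prop) (V : C -> C) (E p q : C) : Prop :=
  exists gamma : R -> C,
    continuous_on (segment 0 1) gamma /\
    gamma 0 = p /\ gamma 1 = q /\
    forall t, segment 0 1 t ->
      D (gamma t) /\
      forall x, turning_point D V E x -> ~ stokes_line D V E x (gamma t).

Definition H3 (D : C -> Prop) (V : C -> C) (beta : R) : Prop :=
  exists r0 eps0 : R, 0 < r0 /\ 0 < eps0 /\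
    forall E : C, r0 <= Cmod E -> Rabs (Im E) <= eps0 * Cmod E ->
      same_stokes_region D V E (RtoC (-1)) (RtoC beta) /\
      same_stokes_region D V E (RtoC 1) (RtoC beta).

(* Re int_sigma^beta sqrt (V(x) + i sigma delta - a - i b) dx = 0. *)
Definition quantization_eq (V : C -> C) (beta delta sigma a b : R) : Prop :=
  exists g : R -> C,
    sqrt_branch sigma beta
      (fun x => (V (RtoC x) + Ci * RtoC sigma * RtoC delta
                 - RtoC a - Ci * RtoC b)%C) g /\
    Re (RInt (V := C_R_CompleteNormedModule) g sigma beta) = 0.

(* Main.v *)
Require Import Defs.
From Stdlib Require Import Reals Lra Psatz.
From Coquelicot Require Import Coquelicot.
Open Scope R_scope.

(** For large [a] the radicand is [-(p + i q)] with [p = a - Re V > 0] and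
    [q = b - Im V - sigma delta]. Writing [sqrt (p + i q) = u + i v] with [u > 0],
    every continuous branch is [i (u + i v)] up to a constant sign, so the equation
    says that [v] has integral [0]. As [q = 2 u v] and [u^2 = p + v^2], [v] is
    strictly increasing and Lipschitz in [q], which gives existence and uniqueness
    by the intermediate value theorem. Finally [q = 2 sqrt a v + O(1/a)], so [q] has
    integral [O(1/a)], which is the expansion of [b]. *)

(** * Real and imaginary parts of the principal square root *)

(** [sqrt_re p q + i sqrt_im p q] is the principal square root of [p + i q];
    only meaningful for [p > 0] (on [p < 0, q = 0] it is [0] by division by [0]). *)
Definition sqrt_re (p q : R) : R := sqrt ((sqrt (p * p + q * q) + p) / 2).
Definition sqrt_im (p q : R) : R := q / (2 * sqrt_re p q).

Lemma sqrt_re_radicand_pos (p q : R) : 0 < p ->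
  0 < (sqrt (p * p + q * q) + p) / 2.
Proof.
  intros hp; pose proof (sqrt_pos (p * p + q * q)); lra.
Qed.

Lemma sqrt_re_pos (p q : R) : 0 < p -> 0 < sqrt_re p q.
Proof.
  intros hp; apply sqrt_lt_R0, sqrt_re_radicand_pos, hp.
Qed.

Lemma sqrt_re_im (p q : R) : 0 < p -> 2 * sqrt_re p q * sqrt_im p q = q.
Proof.
  intros hp; pose proof (sqrt_re_pos p q hp); unfold sqrt_im; field; lra.
Qed.

(** Write [u], [v] for the two parts and [r = sqrt (p^2 + q^2)]. Multiplied by [4 u^2], the claim
    becomes [4 u^4 = 4 u^2 p + q^2], which is [r^2 = p^2 + q^2] because [2 u^2 = r + p]. *)
Lemma sqrt_re_im_sqr (p q : R) : 0 < p ->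
  sqrt_re p q * sqrt_re p q = p + sqrt_im p q * sqrt_im p q.
Proof.
  intros hp.
  pose proof (sqrt_re_pos p q hp) as hu.
  pose proof (sqrt_re_im p q hp) as hq.
  assert (hu2 : sqrt_re p q * sqrt_re p q = (sqrt (p * p + q * q) + p) / 2)
    by (apply sqrt_sqrt, Rlt_le, sqrt_re_radicand_pos, hp).
  assert (hr : sqrt (p * p + q * q) * sqrt (p * p + q * q) = p * p + q * q)
    by (apply sqrt_sqrt; nra).
  set (u := sqrt_re p q) in *; set (v := sqrt_im p q) in *.
  set (r := sqrt (p * p + q * q)) in *.
  apply Rmult_eq_reg_l with (4 * (u * u)); [|nra].
  replace (4 * (u * u) * (p + v * v))
    with (4 * (u * u) * p + (2 * u * v) * (2 * u * v)) by ring.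
  rewrite hq, hu2.
  replace (q * q) with (r * r - p * p) by lra.
  field.
Qed.

(** The increment of [2 u v] splits as [(u1 + u2) (v2 - v1) + (v1 + v2) (u2 - u1)]. The first term
    is large enough because [u >= sqrt p]. The second is nonnegative: times [u1 + u2] it equals
    [(v1 + v2)^2 (v2 - v1)]. Arbitrary [u], [v] are allowed so that the bound also applies to the
    components of a given branch. *)
Lemma two_re_im_increment (p u1 v1 u2 v2 : R) : 0 < p -> 0 < u1 -> 0 < u2 ->
  u1 * u1 = p + v1 * v1 -> u2 * u2 = p + v2 * v2 ->
  v1 < v2 -> 2 * sqrt p * (v2 - v1) <= 2 * u2 * v2 - 2 * u1 * v1.
Proof.
  intros hp hu1 hu2 e1 e2 hv.
  assert (hs : forall u v, 0 < u -> u * u = p + v * v -> sqrt p <= u).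
  { intros u v hu e. rewrite <- (sqrt_square u) by lra. apply sqrt_le_1_alt. nra. }
  pose proof (hs _ _ hu1 e1); pose proof (hs _ _ hu2 e2).
  assert (hd : (u1 + u2) * ((v1 + v2) * (u2 - u1))
               = (v1 + v2) * (v1 + v2) * (v2 - v1)).
  { replace ((u1 + u2) * ((v1 + v2) * (u2 - u1)))
      with ((v1 + v2) * (u2 * u2 - u1 * u1)) by ring.
    rewrite e1, e2; ring. }
  assert (0 <= (v1 + v2) * (u2 - u1)).
  { apply Rmult_le_reg_l with (u1 + u2); [lra|].
    rewrite hd, Rmult_0_r. apply Rmult_le_pos; [apply Rle_0_sqr | lra]. }
  replace (2 * u2 * v2 - 2 * u1 * v1)
    with ((u1 + u2) * (v2 - v1) + (v1 + v2) * (u2 - u1)) by ring.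
  nra.
Qed.

(** A decrease of [sqrt_im] would, by [two_re_im_increment], force [q2 < q1]. The upper bound is the
    Lipschitz estimate behind the continuity of the phase. *)
Lemma sqrt_im_increment (p q1 q2 : R) : 0 < p -> q1 <= q2 ->
  0 <= 2 * sqrt p * (sqrt_im p q2 - sqrt_im p q1) <= q2 - q1.
Proof.
  intros hp hq.
  pose proof (sqrt_lt_R0 p hp).
  pose proof (sqrt_re_pos p q1 hp) as hu1; pose proof (sqrt_re_pos p q2 hp) as hu2.
  pose proof (sqrt_re_im_sqr p q1 hp) as e1; pose proof (sqrt_re_im_sqr p q2 hp) as e2.
  pose proof (sqrt_re_im p q1 hp) as d1; pose proof (sqrt_re_im p q2 hp) as d2.
  destruct (total_order_T (sqrt_im p q1) (sqrt_im p q2)) as [[h | h] | h].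
  - pose proof (two_re_im_increment p _ _ _ _ hp hu1 hu2 e1 e2 h). nra.
  - rewrite h. lra.
  - pose proof (two_re_im_increment p _ _ _ _ hp hu2 hu1 e2 e1 h). nra.
Qed.

(** Equal [v] would give equal [u > 0] through [u^2 = p + v^2], hence equal [q = 2 u v]. *)
Lemma sqrt_im_lt (p q1 q2 : R) : 0 < p -> q1 < q2 -> sqrt_im p q1 < sqrt_im p q2.
Proof.
  intros hp hq.
  pose proof (sqrt_lt_R0 p hp) as hs.
  destruct (sqrt_im_increment p q1 q2 hp (Rlt_le _ _ hq)) as [h _].
  destruct (Rle_lt_dec (sqrt_im p q2) (sqrt_im p q1)) as [h' | h']; [|exact h'].
  assert (e : sqrt_im p q1 = sqrt_im p q2) by nra.
  pose proof (sqrt_re_im_sqr p q1 hp) as e1; pose proof (sqrt_re_im_sqr p q2 hp) as e2.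
  pose proof (sqrt_re_pos p q1 hp); pose proof (sqrt_re_pos p q2 hp).
  pose proof (sqrt_re_im p q1 hp) as d1; pose proof (sqrt_re_im p q2 hp) as d2.
  rewrite e in e1, d1.
  assert (sqrt_re p q1 = sqrt_re p q2) by nra.
  nra.
Qed.

(** Two different values of [v] would give different values of [2 u v] by [two_re_im_increment].
    This identifies the components of an arbitrary branch. *)
Lemma sqrt_im_unique (p q u v : R) : 0 < p -> 0 < u ->
  u * u = p + v * v -> 2 * u * v = q -> v = sqrt_im p q.
Proof.
  intros hp hu e d.
  pose proof (sqrt_re_pos p q hp) as hu'.
  pose proof (sqrt_re_im_sqr p q hp) as e'.
  pose proof (sqrt_re_im p q hp) as d'.
  pose proof (sqrt_lt_R0 p hp).
  destruct (total_order_T v (sqrt_im p q)) as [[h | h] | h]; [|exact h|].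
  - pose proof (two_re_im_increment p _ _ _ _ hp hu hu' e e' h). nra.
  - pose proof (two_re_im_increment p _ _ _ _ hp hu' hu e' e h). nra.
Qed.

Lemma sqrt_im_0 (p : R) : sqrt_im p 0 = 0.
Proof. unfold sqrt_im, Rdiv; ring. Qed.

Lemma continuous_sqrt_re (p q : R -> R) (x : R) :
  continuous p x -> continuous q x ->
  continuous (fun t => sqrt_re (p t) (q t)) x.
Proof.
  intros hp hq.
  unfold sqrt_re.
  apply (continuous_comp (fun t => (sqrt (p t * p t + q t * q t) + p t) / 2) sqrt);
    [|apply continuous_sqrt].
  apply (continuous_mult (K := R_AbsRing)); [|apply continuous_const].
  apply (continuous_plus (V := R_NormedModule)); [|exact hp].
  apply (continuous_comp (fun t => p t * p t + q t * q t) sqrt);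
    [|apply continuous_sqrt].
  apply (continuous_plus (V := R_NormedModule));
    apply (continuous_mult (K := R_AbsRing)); assumption.
Qed.

Lemma continuous_sqrt_im (p q : R -> R) (x : R) : 0 < p x ->
  continuous p x -> continuous q x ->
  continuous (fun t => sqrt_im (p t) (q t)) x.
Proof.
  intros h hp hq.
  unfold sqrt_im, Rdiv.
  apply (continuous_mult (K := R_AbsRing)); [exact hq|].
  apply continuous_Rinv_comp.
  - apply (continuous_mult (K := R_AbsRing)); [apply continuous_const|].
    apply continuous_sqrt_re; assumption.
  - pose proof (sqrt_re_pos (p x) (q x) h). lra.
Qed.

(* With [u = sqrt_re p q], [v = sqrt_im p q] and [q = 2 u v], the difference is
   [2 v (u^2 - a) / (u + sqrt a)], where [v], [u^2 - a] are bounded and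
   [u^2 >= a / 2]. *)
Lemma sqrt_im_asymp (a M p q : R) : 1 <= M -> 2 * M + 2 <= a ->
  Rabs (p - a) <= M -> Rabs q <= 2 * M ->
  Rabs (q - 2 * sqrt a * sqrt_im p q) <= 8 * (M * M * M) / a.
Proof.
  intros hM ha hp hq.
  apply Rabs_le_between in hp. apply Rabs_le_between in hq.
  assert (hp0 : 0 < p) by lra.
  pose proof (sqrt_re_pos p q hp0) as hu.
  pose proof (sqrt_re_im_sqr p q hp0) as e.
  pose proof (sqrt_re_im p q hp0) as d.
  set (u := sqrt_re p q) in *; set (v := sqrt_im p q) in *.
  assert (hs : 0 < sqrt a) by (apply sqrt_lt_R0; lra).
  assert (hss : sqrt a * sqrt a = a) by (apply sqrt_sqrt; lra).
  set (s := sqrt a) in *.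
  assert (hu2 : a / 2 <= u * u) by nra.
  assert (hu1 : 1 <= u) by nra.
  assert (hv : Rabs (u * v) <= M).
  { apply Rabs_le_between; lra. }
  assert (hv2 : 0 <= v * v <= M * M).
  { split; [nra|].
    assert (v * v <= (u * v) * (u * v)).
    { replace ((u * v) * (u * v)) with ((u * u) * (v * v)) by ring. nra. }
    apply Rabs_le_between in hv. nra. }
  (* [u^2 - a = (p - a) + v^2] is at most [M + M^2 <= 2 M^2] in absolute value, and [u <= u + s]. *)
  assert (hw : Rabs (u * (u - s)) <= 2 * (M * M)).
  { assert (Rabs ((u + s) * (u - s)) <= 2 * (M * M)).
    { replace ((u + s) * (u - s)) with (p - a + v * v) by nra.
      apply Rabs_le_between. nra. }
    apply Rle_trans with (2 := H).
    rewrite !Rabs_mult. apply Rmult_le_compat_r; [apply Rabs_pos|].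
    rewrite !Rabs_pos_eq; lra. }
  (* Scaling by [a / 2 <= u^2] removes the denominators: [u^2 (q - 2 s v)] is twice the product of
     the bounded quantities [u v] and [u (u - s)]. *)
  apply Rmult_le_reg_l with (a / 2); [lra|].
  replace (a / 2 * (8 * (M * M * M) / a)) with (2 * (M * (2 * (M * M))))
    by (field; lra).
  apply Rle_trans with (u * u * Rabs (q - 2 * s * v)).
  { apply Rmult_le_compat_r; [apply Rabs_pos | exact hu2]. }
  rewrite <- (Rabs_pos_eq (u * u)) by nra.
  rewrite <- Rabs_mult.
  replace (u * u * (q - 2 * s * v)) with (2 * ((u * v) * (u * (u - s))))
    by (rewrite <- d; ring).
  rewrite Rabs_mult, (Rabs_pos_eq 2) by lra.
  apply Rmult_le_compat_l; [lra|].
  rewrite Rabs_mult.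
  apply Rmult_le_compat; auto using Rabs_pos.
Qed.

(** * The phase integral: monotonicity in [b], its root, and the expansion of the root *)

(** Up to sign, the integrand is the real part of a square root of [(P - a) + i (Q - b)]; the
    theorem takes [P + i Q = V + i sigma delta]. *)
Definition phase (P Q : R -> R) (l r a b : R) : R :=
  RInt (fun x => sqrt_im (a - P x) (b - Q x)) l r.

Section Phase.

Variables (P Q : R -> R) (l r M : R).
Hypotheses (hlr : l < r) (hM : 1 <= M).
Hypotheses (hPc : forall x, continuous P x) (hQc : forall x, continuous Q x).
Hypotheses (hPM : forall x, Rabs (P x) <= M) (hQM : forall x, Rabs (Q x) <= M).

Lemma continuous_phase_integrand (a b x : R) : M < a ->
  continuous (fun x => sqrt_im (a - P x) (b - Q x)) x.
Proof.
  intros ha.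
  pose proof (hPM x) as h; apply Rabs_le_between in h.
  apply (continuous_sqrt_im (fun t => a - P t) (fun t => b - Q t)); [lra| |];
    apply (continuous_minus (V := R_NormedModule)); auto using continuous_const.
Qed.

Lemma ex_RInt_phase_integrand (a b : R) : M < a ->
  ex_RInt (fun x => sqrt_im (a - P x) (b - Q x)) l r.
Proof.
  intros ha.
  apply (ex_RInt_continuous (V := R_CompleteNormedModule)).
  intros z _; apply continuous_phase_integrand, ha.
Qed.

Lemma phase_lt (a b1 b2 : R) : M < a -> b1 < b2 ->
  phase P Q l r a b1 < phase P Q l r a b2.
Proof.
  intros ha hb.
  apply RInt_lt; auto using continuous_phase_integrand.
  intros x _. pose proof (hPM x) as h; apply Rabs_le_between in h.
  apply sqrt_im_lt; lra.
Qed.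

(** For [a > M + 1] the quantity [a - P x] stays above [1], so [sqrt_im_increment] bounds the slope
    of the integrand in [b] by [1/2]. *)
Lemma phase_lipschitz (a b1 b2 : R) : M + 1 < a ->
  Rabs (phase P Q l r a b2 - phase P Q l r a b1) <= (r - l) * Rabs (b2 - b1).
Proof.
  intros ha.
  unfold phase.
  rewrite <- (RInt_minus (V := R_CompleteNormedModule))
    by (apply ex_RInt_phase_integrand; lra).
  apply abs_RInt_le_const.
  - lra.
  - apply (ex_RInt_minus (V := R_NormedModule));
      apply ex_RInt_phase_integrand; lra.
  - intros x _. pose proof (hPM x) as h; apply Rabs_le_between in h.
    assert (hp : 1 <= sqrt (a - P x)).
    { rewrite <- sqrt_1. apply sqrt_le_1_alt. lra. }
    change (Rabs (sqrt_im (a - P x) (b2 - Q x) - sqrt_im (a - P x) (b1 - Q x))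
            <= Rabs (b2 - b1)).
    destruct (Rle_lt_dec b1 b2) as [hb | hb].
    + destruct (sqrt_im_increment (a - P x) (b1 - Q x) (b2 - Q x)); [lra.. |].
      rewrite !Rabs_pos_eq; nra.
    + destruct (sqrt_im_increment (a - P x) (b2 - Q x) (b1 - Q x)); [lra.. |].
      rewrite Rabs_minus_sym, (Rabs_minus_sym b2), !Rabs_pos_eq; nra.
Qed.

Lemma continuity_phase (a : R) : M + 1 < a -> continuity (phase P Q l r a).
Proof.
  intros ha b.
  intros eps heps.
  exists (eps / (r - l)); split.
  { apply Rdiv_lt_0_compat; lra. }
  intros x [_ hx]. simpl in *. unfold R_dist in *.
  apply Rle_lt_trans with (1 := phase_lipschitz a b x ha).
  replace eps with ((r - l) * (eps / (r - l))) by (field; lra).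
  apply Rmult_lt_compat_l; lra.
Qed.

(** Since [Q <= M < b], the integrand is positive everywhere. Together with [phase_neg] this gives
    the sign change for the intermediate value theorem and confines every root to [[-M, M]]. *)
Lemma phase_pos (a b : R) : M < a -> M < b -> 0 < phase P Q l r a b.
Proof.
  intros ha hb.
  apply Rle_lt_trans with (RInt (fun _ => 0) l r).
  { rewrite RInt_const. unfold scal; simpl; unfold mult; simpl; lra. }
  apply RInt_lt; auto using continuous_phase_integrand, continuous_const.
  intros x _. pose proof (hPM x) as h; apply Rabs_le_between in h.
  pose proof (hQM x) as h'; apply Rabs_le_between in h'.
  rewrite <- (sqrt_im_0 (a - P x)). apply sqrt_im_lt; lra.
Qed.

Lemma phase_neg (a b : R) : M < a -> b < - M -> phase P Q l r a b < 0.
Proof.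
  intros ha hb.
  apply Rlt_le_trans with (RInt (fun _ => 0) l r).
  2:{ rewrite RInt_const. unfold scal; simpl; unfold mult; simpl; lra. }
  apply RInt_lt; auto using continuous_phase_integrand, continuous_const.
  intros x _. pose proof (hPM x) as h; apply Rabs_le_between in h.
  pose proof (hQM x) as h'; apply Rabs_le_between in h'.
  rewrite <- (sqrt_im_0 (a - P x)). apply sqrt_im_lt; lra.
Qed.

(** The [sig] form lets the theorem turn the root into a function of [a]. *)
Lemma phase_root_exists (a : R) : M + 1 < a -> {b : R | phase P Q l r a b = 0}.
Proof.
  intros ha.
  pose proof (phase_pos a (M + 1)) as h1; pose proof (phase_neg a (- (M + 1))) as h2.
  destruct (IVT_cor (phase P Q l r a) (- (M + 1)) (M + 1)) as [b [_ hb]].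
  - apply continuity_phase, ha.
  - lra.
  - apply Rlt_le in h1; [|lra..]. apply Rlt_le in h2; [|lra..]. nra.
  - exists b; exact hb.
Qed.

Lemma phase_root_unique (a b1 b2 : R) : M < a ->
  phase P Q l r a b1 = 0 -> phase P Q l r a b2 = 0 -> b1 = b2.
Proof.
  intros ha h1 h2.
  destruct (total_order_T b1 b2) as [[h | h] | h]; [|exact h|];
    pose proof (phase_lt a _ _ ha h); lra.
Qed.

(** Integrate [sqrt_im_asymp] over [[l, r]]: the term [2 sqrt a v] contributes [2 sqrt a] times the
    phase, which vanishes, so only [(r - l) b - RInt Q l r] remains. *)
Lemma phase_root_asymp (a b : R) : 2 * M + 2 <= a -> phase P Q l r a b = 0 ->
  Rabs (b - RInt Q l r / (r - l)) <= 8 * (M * M * M) * (1 / a).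
Proof.
  intros ha hb.
  (* This gives [Rabs (b - Q x) <= 2 * M], as [sqrt_im_asymp] requires. *)
  assert (hbM : - M <= b <= M).
  { split; apply Rnot_lt_le; intros h;
      [pose proof (phase_neg a b) | pose proof (phase_pos a b)]; lra. }
  assert (hex : ex_RInt (fun x => sqrt_im (a - P x) (b - Q x)) l r)
    by (apply ex_RInt_phase_integrand; lra).
  assert (hQex : ex_RInt Q l r)
    by (apply (ex_RInt_continuous (V := R_CompleteNormedModule)); auto).
  assert (hI : is_RInt (fun x => (b - Q x)
                 - 2 * sqrt a * sqrt_im (a - P x) (b - Q x)) l r
                 (((r - l) * b - RInt Q l r) - 2 * sqrt a * phase P Q l r a b)).
  { apply (is_RInt_minus (V := R_NormedModule)).
    - apply (is_RInt_minus (V := R_NormedModule)).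
      + apply (is_RInt_const (V := R_NormedModule)).
      + apply (RInt_correct (V := R_CompleteNormedModule)), hQex.
    - apply (is_RInt_scal (V := R_NormedModule)).
      apply (RInt_correct (V := R_CompleteNormedModule)), hex. }
  rewrite hb, Rmult_0_r, Rminus_0_r in hI.
  assert (hbd : Rabs ((r - l) * b - RInt Q l r) <= (r - l) * (8 * (M * M * M) / a)).
  { rewrite <- (is_RInt_unique _ _ _ _ hI).
    apply abs_RInt_le_const; [lra | eexists; exact hI |].
    intros x _. pose proof (hPM x) as h; apply Rabs_le_between in h.
    pose proof (hQM x) as h'; apply Rabs_le_between in h'.
    apply sqrt_im_asymp; auto; apply Rabs_le_between; lra. }
  apply Rmult_le_reg_l with (r - l); [lra|].
  rewrite <- (Rabs_pos_eq (r - l)) at 1 by lra.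
  rewrite <- Rabs_mult.
  replace ((r - l) * (b - RInt Q l r / (r - l)))
    with ((r - l) * b - RInt Q l r) by (field; lra).
  replace (8 * (M * M * M) * (1 / a)) with (8 * (M * M * M) / a) by (field; lra).
  exact hbd.
Qed.

End Phase.

(** * Continuous extension from a segment to the whole line *)

(** The nearest-point projection onto the segment. Composing with it turns functions controlled only
    on the segment into functions continuous on all of [R]. *)
Definition clamp (a b x : R) : R := Rmax (Rmin a b) (Rmin (Rmax a b) x).

Lemma segment_clamp (a b x : R) : segment a b (clamp a b x).
Proof.
  unfold segment, clamp.
  pose proof (Rmin_Rmax a b); split; [apply Rmax_l|].
  apply Rmax_lub; [assumption | apply Rmin_l].
Qed.

Lemma clamp_id (a b x : R) : segment a b x -> clamp a b x = x.
Proof.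
  intros [h1 h2]; unfold clamp.
  rewrite (Rmin_right (Rmax a b) x h2); apply Rmax_right, h1.
Qed.

Lemma continuous_clamp (a b x : R) : continuous (clamp a b) x.
Proof.
  assert (lip : forall u v, Rabs (clamp a b u - clamp a b v) <= Rabs (u - v)).
  { intros u v. unfold clamp.
    pose proof (Rmin_Rmax a b) as h.
    generalize dependent (Rmax a b); intros n h; revert h.
    generalize (Rmin a b); intros m h.
    unfold Rmax, Rmin, Rabs.
    repeat destruct Rle_dec; repeat destruct Rcase_abs; lra. }
  apply filterlim_locally; intros eps.
  exists eps; intros y hy.
  apply Rle_lt_trans with (1 := lip y x), hy.
Qed.

Lemma continuous_on_clamp {U : UniformSpace} (a b : R) (f : R -> U) (x : R) :
  continuous_on (segment a b) f -> continuous (fun t => f (clamp a b t)) x.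
Proof.
  intros hf.
  refine (filterlim_comp _ _ _ (clamp a b) f _ _ _ _ (hf _ (segment_clamp a b x))).
  intros P hP.
  change (locally x (fun t => P (clamp a b t))).
  apply (filter_imp (fun t => segment a b (clamp a b t) -> P (clamp a b t))).
  - intros t ht; exact (ht (segment_clamp a b t)).
  - exact (continuous_clamp a b x _ hP).
Qed.

Lemma holomorphic_continuous_on_segment (D : C -> Prop) (V : C -> C) (a b : R) :
  holomorphic_on D V -> (forall x, segment a b x -> D (RtoC x)) ->
  continuous_on (U := C_UniformSpace) (segment a b) (fun x : R => V (RtoC x)).
Proof.
  intros hV hD x hx.
  pose proof (ex_derive_continuous V (RtoC x) (hV _ (hD x hx))) as hc.
  apply (filterlim_filter_le_1 (F := locally x)); [apply filter_le_within|].
  intros P hP.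
  (* Complex differentiability refers to the topology of the modulus; [locally_C] passes to the
     product topology, whose balls restrict to intervals on the real axis. *)
  pose proof (proj2 (locally_C (RtoC x) (fun z => P (V z))) (hc P hP)) as [eps he].
  exists eps; intros y hy.
  apply he; split; [exact hy | apply ball_center].
Qed.

Lemma continuous_fst_C (f : R -> C) (x : R) :
  continuous (U := C_UniformSpace) f x -> continuous (fun t => fst (f t)) x.
Proof.
  intros h. apply (continuous_comp f fst x h).
  apply (continuous_fst (U := R_UniformSpace) (V := R_UniformSpace)).
Qed.

Lemma continuous_snd_C (f : R -> C) (x : R) :
  continuous (U := C_UniformSpace) f x -> continuous (fun t => snd (f t)) x.
Proof.
  intros h. apply (continuous_comp f snd x h).
  apply (continuous_snd (U := R_UniformSpace) (V := R_UniformSpace)).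
Qed.

Lemma continuous_clamp_bounded (a b : R) (f : R -> R) : a <= b ->
  (forall x, continuous (fun t => f (clamp a b t)) x) ->
  exists M, forall x, Rabs (f (clamp a b x)) <= M.
Proof.
  intros hab hf.
  destruct (continuity_ab_maj (fun t => Rabs (f (clamp a b t))) a b hab)
    as [m [hm _]].
  { intros c _. apply continuity_pt_filterlim.
    apply (continuous_Rabs_comp (fun t => f (clamp a b t))), hf. }
  exists (Rabs (f (clamp a b m))); intros x.
  pose proof (segment_clamp a b x) as h.
  rewrite <- (clamp_id a b _ h). apply hm.
  unfold segment in h. rewrite Rmin_left, Rmax_right in h; assumption.
Qed.

(** * Derivatives on a segment and the fundamental theorem of calculus *)

Lemma is_derive_on_continuous (a b : R) (f df : R -> C) :
  is_derive_on a b f df -> continuous_on (U := C_UniformSpace) (segment a b) f.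
Proof.
  intros hf x hx.
  apply (filterdiff_continuous_aux (U := R_NormedModule) (V := C_R_NormedModule)).
  - eexists; exact (hf x hx).
  - intros P hP. apply filter_le_within, hP.
Qed.

Lemma is_derive_on_interior (a b : R) (f df : R -> C) (x : R) :
  is_derive_on a b f df -> Rmin a b < x < Rmax a b ->
  is_derive (V := C_R_NormedModule) f x (df x).
Proof.
  intros hf hx.
  assert (hloc : locally x (segment a b)).
  { apply (locally_interval _ x (Rmin a b) (Rmax a b)); simpl; try tauto.
    intros y h1 h2; split; apply Rlt_le; assumption. }
  destruct (hf x (conj (Rlt_le _ _ (proj1 hx)) (Rlt_le _ _ (proj2 hx)))) as [hl hd].
  split; [exact hl|].
  intros y hy eps.
  assert (hy' : is_filter_lim (within (segment a b) (locally x)) y).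
  { intros P hP. apply filter_le_within, hy, hP. }
  generalize (filter_and _ _ hloc (hd y hy' eps)).
  apply filter_imp; intros t [ht1 ht2]; exact (ht2 ht1).
Qed.

(** At an end point of the segment only a one-sided derivative is at hand. The mean value theorem is
    therefore applied to [h], the difference of the clamped function and the integral: it has
    derivative [0] in the interior and is continuous up to the ends. *)
Lemma RInt_Im_derive (a b c d : R) (f df : R -> C) :
  is_derive_on a b f df -> continuous_on (U := C_UniformSpace) (segment a b) df ->
  segment a b c -> segment a b d ->
  RInt (fun t => Im (df (clamp a b t))) c d = Im (f d) - Im (f c).
Proof.
  intros hf hdf hc hd.
  set (w := fun t => Im (df (clamp a b t))).
  set (h := fun x => Im (f (clamp a b x)) - RInt w c x).
  assert (hw : forall x, continuous w x).
  { intros x. apply continuous_snd_C.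
    apply (continuous_on_clamp (U := C_UniformSpace)), hdf. }
  assert (hwd : forall x, is_derive (RInt w c) x (w x)).
  { intros x. apply (is_derive_RInt w (RInt w c) c x).
    - apply filter_forall; intros y.
      apply (RInt_correct (V := R_CompleteNormedModule)).
      apply (ex_RInt_continuous (V := R_CompleteNormedModule)); auto.
    - apply hw. }
  assert (hfi : forall x, Rmin a b < x < Rmax a b ->
      is_derive (fun t => Im (f (clamp a b t))) x (w x)).
  { intros x hx.
    assert (hs : segment a b x) by (split; apply Rlt_le; tauto).
    apply (is_derive_ext_loc (fun t => Im (f t))).
    { apply (locally_interval _ x (Rmin a b) (Rmax a b)); simpl; try tauto.
      intros y h1 h2. rewrite clamp_id; [reflexivity|].
      split; apply Rlt_le; assumption. }
    unfold w; rewrite clamp_id by exact hs.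
    apply (filterdiff_ext_lin (U := R_NormedModule) (V := R_NormedModule)
      (fun t => Im (f t)) (fun y : R => snd (scal y (df x : C_R_NormedModule))));
      [|reflexivity].
    apply (filterdiff_comp (U := R_NormedModule) (V := C_R_NormedModule)
      (W := R_NormedModule) f snd (fun y => scal y (df x)) snd).
    - exact (is_derive_on_interior a b f df x hf hx).
    - apply filterdiff_linear.
      apply (is_linear_snd (K := R_AbsRing) (U := R_NormedModule)
        (V := R_NormedModule)). }
  destruct (MVT_gen h c d (fun _ => 0)) as [z [_ hz]].
  - intros x hx.
    assert (hx' : Rmin a b < x < Rmax a b).
    { unfold segment in hc, hd. split.
      - apply Rle_lt_trans with (2 := proj1 hx). apply Rmin_glb; tauto.
      - apply Rlt_le_trans with (1 := proj2 hx). apply Rmax_lub; tauto. }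
    replace 0 with (w x - w x) by ring.
    apply (is_derive_minus (V := R_NormedModule)); auto.
  - intros x _. apply continuity_pt_filterlim.
    apply (continuous_minus (V := R_NormedModule)).
    + apply continuous_snd_C, (continuous_on_clamp (U := C_UniformSpace)).
      apply is_derive_on_continuous with df, hf.
    + apply (ex_derive_continuous (V := R_NormedModule)).
      exists (w x); apply hwd.
  - unfold h in hz. rewrite !clamp_id in hz by assumption.
    rewrite RInt_point in hz. unfold zero in hz; simpl in hz. lra.
Qed.

(** * From continuous branches of the complex square root to the real phase *)

Lemma Re_RInt (c d : R) (g : R -> C) :
  continuous_on (U := C_UniformSpace) (segment c d) g ->
  Re (RInt (V := C_R_CompleteNormedModule) g c d) = RInt (fun t => Re (g t)) c d.
Proof.
  intros hg.
  assert (hg' : forall x, continuous (U := C_UniformSpace)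
                            (fun t => g (clamp c d t)) x)
    by (intros x; apply (continuous_on_clamp (U := C_UniformSpace)), hg).
  assert (hext : forall x, Rmin c d < x < Rmax c d -> clamp c d x = x)
    by (intros x hx; apply clamp_id; split; apply Rlt_le; apply hx).
  assert (h1 : ex_RInt (fun t => fst (g t)) c d).
  { apply (ex_RInt_ext (fun t => fst (g (clamp c d t)))).
    - intros x hx; rewrite hext by exact hx; reflexivity.
    - apply (ex_RInt_continuous (V := R_CompleteNormedModule)); intros x _.
      apply continuous_fst_C, hg'. }
  assert (h2 : ex_RInt (fun t => snd (g t)) c d).
  { apply (ex_RInt_ext (fun t => snd (g (clamp c d t)))).
    - intros x hx; rewrite hext by exact hx; reflexivity.
    - apply (ex_RInt_continuous (V := R_CompleteNormedModule)); intros x _.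
      apply continuous_snd_C, hg'. }
  rewrite (is_RInt_unique (V := C_R_CompleteNormedModule) g c d
    (RInt (fun t => fst (g t)) c d, RInt (fun t => snd (g t)) c d)).
  - reflexivity.
  - apply (is_RInt_fct_extend_pair (U := R_NormedModule) (V := R_NormedModule));
      apply (RInt_correct (V := R_CompleteNormedModule)); assumption.
Qed.

Lemma continuous_on_nonzero_sign (c d : R) (f : R -> R) :
  continuous_on (segment c d) f -> (forall t, segment c d t -> f t <> 0) ->
  (forall t, segment c d t -> 0 < f t) \/ (forall t, segment c d t -> f t < 0).
Proof.
  intros hf hn.
  assert (same : forall s t, segment c d s -> segment c d t ->
                   0 < f s -> f t < 0 -> False).
  { intros s t hs ht h1 h2.
    destruct (IVT_gen (fun x => f (clamp c d x)) s t 0) as [z [_ hz]].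
    - intros x; apply continuity_pt_filterlim, continuous_on_clamp, hf.
    - rewrite !clamp_id by assumption.
      rewrite Rmin_right, Rmax_left; lra.
    - exact (hn _ (segment_clamp c d z) hz). }
  pose proof (segment_clamp c d c) as hc.
  destruct (Rdichotomy _ _ (hn _ hc)) as [h | h]; [right | left];
    intros t ht; destruct (Rdichotomy _ _ (hn t ht)) as [h' | h'];
    auto; exfalso; eauto.
Qed.

(** For any branch [g], [(Im g)^2 = (Re g)^2 + (a - P) > 0], so [Im g] keeps one sign on the
    segment. That sign decides whether [Re g] is [- sqrt_im] or [sqrt_im] throughout, and the real
    part of the integral is the phase up to sign. *)
Lemma sqrt_branch_phase (P Q : R -> R) (c d a b : R) (f : R -> C) :
  (forall x, continuous P x) -> (forall x, continuous Q x) ->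
  (forall x, P x < a) ->
  (forall x, segment c d x -> f x = (P x - a, Q x - b)) ->
  (exists g, sqrt_branch c d f g /\
     Re (RInt (V := C_R_CompleteNormedModule) g c d) = 0)
  <-> phase P Q c d a b = 0.
Proof.
  intros hP hQ ha hf.
  assert (hp : forall x, 0 < a - P x) by (intros x; specialize (ha x); lra).
  assert (hPc : forall x, continuous (fun t => a - P t) x).
  { intros x. apply (continuous_minus (V := R_NormedModule));
      auto using continuous_const. }
  assert (hQc : forall x, continuous (fun t => b - Q t) x).
  { intros x. apply (continuous_minus (V := R_NormedModule));
      auto using continuous_const. }
  assert (hvc : forall x, continuous (fun t => sqrt_im (a - P t) (b - Q t)) x).
  { intros x. apply (continuous_sqrt_im (fun t => a - P t) (fun t => b - Q t)); auto. }
  assert (hvex : ex_RInt (fun t => sqrt_im (a - P t) (b - Q t)) c d)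
    by (apply (ex_RInt_continuous (V := R_CompleteNormedModule)); auto).
  split.
  - intros [g [[hgc hg] hI]].
    rewrite Re_RInt in hI by exact hgc.
    assert (hre : forall t, segment c d t ->
        Re (g t) * Re (g t) - Im (g t) * Im (g t) = - (a - P t) /\
        2 * Re (g t) * Im (g t) = - (b - Q t)).
    { intros t ht. specialize (hg t ht). rewrite (hf t ht) in hg.
      unfold Cmult in hg. injection hg as e1 e2. unfold Re, Im. lra. }
    assert (hys : (forall t, segment c d t -> 0 < Im (g t)) \/
                  (forall t, segment c d t -> Im (g t) < 0)).
    { apply continuous_on_nonzero_sign.
      - intros t ht.
        apply (filterlim_comp _ _ _ g Im _ _ _ (hgc t ht)).
        apply (continuous_snd (U := R_UniformSpace) (V := R_UniformSpace)).
      - intros t ht h0. destruct (hre t ht) as [e _]. rewrite h0 in e.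
        specialize (hp t). nra. }
    assert (hseg : forall t, Rmin c d < t < Rmax c d -> segment c d t)
      by (intros t ht; split; apply Rlt_le; apply ht).
    (* If [Im g > 0], then [- i g = Im g - i Re g] is the square root of [(a - P) + i (b - Q)] with
       positive real part; otherwise [i g] is. *)
    destruct hys as [hy | hy].
    + rewrite (RInt_ext _ (fun t => opp (sqrt_im (a - P t) (b - Q t)))) in hI.
      * rewrite (RInt_opp (V := R_CompleteNormedModule)) in hI by exact hvex.
        apply Ropp_eq_0_compat in hI. rewrite <- hI.
        symmetry; apply Ropp_involutive.
      * intros t ht. destruct (hre t (hseg t ht)) as [e1 e2].
        rewrite <- (sqrt_im_unique _ _ (Im (g t)) (- Re (g t)) (hp t));
          [symmetry; apply Ropp_involutive | exact (hy t (hseg t ht)) | lra | lra].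
    + rewrite (RInt_ext _ (fun t => sqrt_im (a - P t) (b - Q t))) in hI;
        [exact hI|].
      intros t ht. destruct (hre t (hseg t ht)) as [e1 e2].
      apply (sqrt_im_unique _ _ (- Im (g t)) _ (hp t));
        [pose proof (hy t (hseg t ht)); lra | lra | lra].
  - intros hI.
    (* This is [i (u + i v)], whose square is [- (p + i q)]. *)
    exists (fun t => (- sqrt_im (a - P t) (b - Q t), sqrt_re (a - P t) (b - Q t))).
    assert (hgc : continuous_on (U := C_UniformSpace) (segment c d)
      (fun t => (- sqrt_im (a - P t) (b - Q t), sqrt_re (a - P t) (b - Q t)))).
    { intros t _.
      apply (filterlim_filter_le_1 (F := locally t)); [apply filter_le_within|].
      apply (continuous_comp_2 (V := R_UniformSpace) (W := R_UniformSpace)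
        (X := C_UniformSpace)
        (fun t => - sqrt_im (a - P t) (b - Q t))
        (fun t => sqrt_re (a - P t) (b - Q t)) (fun x y => (x, y) : C)).
      - apply (continuous_opp (V := R_NormedModule)), hvc.
      - apply (continuous_sqrt_re (fun t => a - P t) (fun t => b - Q t)); auto.
      - apply (continuous_ext (fun z => z)); [intros [x y]; reflexivity|].
        apply continuous_id. }
    split; [split; [exact hgc|]|].
    + intros t ht. rewrite (hf t ht).
      pose proof (sqrt_re_im_sqr (a - P t) (b - Q t) (hp t)).
      pose proof (sqrt_re_im (a - P t) (b - Q t) (hp t)).
      unfold Cmult; simpl. f_equal; lra.
    + rewrite Re_RInt by exact hgc.
      unfold Re; simpl.
      transitivity (opp (phase P Q c d a b)).
      * apply (RInt_opp (V := R_CompleteNormedModule)), hvex.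
      * rewrite hI. apply Ropp_0.
Qed.

(** For [sigma = 1] the path from [sigma] to [beta] runs backwards; reversal only changes the sign
    of the phase, so its zeros are those on the ordered interval. *)
Lemma phase_segment (P Q : R -> R) (c d a b : R) :
  (forall x, continuous (fun t => sqrt_im (a - P t) (b - Q t)) x) ->
  phase P Q c d a b = 0 <-> phase P Q (Rmin c d) (Rmax c d) a b = 0.
Proof.
  intros hc.
  destruct (Rle_lt_dec c d) as [h | h].
  - rewrite Rmin_left, Rmax_right by exact h. reflexivity.
  - rewrite Rmin_right, Rmax_left by lra.
    unfold phase.
    rewrite <- (opp_RInt_swap (V := R_CompleteNormedModule)).
    + unfold opp; simpl; lra.
    + apply (ex_RInt_continuous (V := R_CompleteNormedModule)); auto.
Qed.

(** * Existence, uniqueness and expansion of [b(a)] from the phase on the ordered interval *)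

Theorem theorem7 (D : C -> Prop) (V : C -> C) (Y : R -> C)
    (beta delta sigma : R)
    (hD : complex_domain D)
    (hseg : forall x : R, -1 <= x <= 1 -> D (RtoC x))
    (hV : holomorphic_on D V)
    (hbeta : -1 < beta < 1)
    (hdelta : 0 <= delta)
    (h1 : H1 D V)
    (h3 : H3 D V beta)
    (hY : is_derive_on (-1) 1 Y (fun x => V (RtoC x)))
    (hsigma : sigma = 1 \/ sigma = -1) :
  exists b : R -> R,
    Rbar_locally p_infty
      (fun a => unique (quantization_eq V beta delta sigma a) (b a)) /\
    exists K : R,
      Rbar_locally p_infty
        (fun a => Rabs (b a - (1 / (beta - sigma) * Im (Y beta - Y sigma)%C
                               + sigma * delta)) <= K * (1 / a)).
Proof.
  assert (hseg' : forall x, segment (-1) 1 x <-> -1 <= x <= 1).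
  { intros x. unfold segment. rewrite Rmin_left, Rmax_right by lra. reflexivity. }
  assert (hVc : continuous_on (U := C_UniformSpace) (segment (-1) 1)
                  (fun x : R => V (RtoC x))).
  { apply holomorphic_continuous_on_segment with D; [exact hV|].
    intros x hx; apply hseg, hseg', hx. }
  set (P := fun x => Re (V (RtoC (clamp (-1) 1 x)))).
  set (I := fun x => Im (V (RtoC (clamp (-1) 1 x)))).
  set (Q := fun x => I x + sigma * delta).
  assert (hPc : forall x, continuous P x).
  { intros x. apply (continuous_fst_C (fun t => V (RtoC (clamp (-1) 1 t)))).
    apply (continuous_on_clamp (U := C_UniformSpace) _ _
      (fun t : R => V (RtoC t))), hVc. }
  assert (hIc : forall x, continuous I x).
  { intros x. apply (continuous_snd_C (fun t => V (RtoC (clamp (-1) 1 t)))).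
    apply (continuous_on_clamp (U := C_UniformSpace) _ _
      (fun t : R => V (RtoC t))), hVc. }
  assert (hQc : forall x, continuous Q x).
  { intros x. apply (continuous_plus (V := R_NormedModule));
      [apply hIc | apply continuous_const]. }
  destruct (continuous_clamp_bounded (-1) 1 (fun x => Re (V (RtoC x))))
    as [M1 hM1]; [lra | exact hPc |].
  destruct (continuous_clamp_bounded (-1) 1 (fun x => Im (V (RtoC x)) + sigma * delta))
    as [M2 hM2]; [lra | exact hQc |].
  (* The [1] in the maximum provides [1 <= M], used in [sqrt_im_asymp] to absorb [M] into [M^2]. *)
  set (M := Rmax 1 (Rmax M1 M2)).
  assert (hM : 1 <= M) by apply Rmax_l.
  assert (hPM : forall x, Rabs (P x) <= M).
  { intros x. apply Rle_trans with (1 := hM1 x).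
    apply Rle_trans with (Rmax M1 M2); [apply Rmax_l | apply Rmax_r]. }
  assert (hQM : forall x, Rabs (Q x) <= M).
  { intros x. apply Rle_trans with (1 := hM2 x).
    apply Rle_trans with (Rmax M1 M2); [apply Rmax_r | apply Rmax_r]. }
  set (l := Rmin sigma beta); set (r := Rmax sigma beta).
  assert (hlr : l < r).
  { unfold l, r, Rmin, Rmax. destruct Rle_dec; lra. }
  assert (hsub : forall x, segment sigma beta x -> segment (-1) 1 x).
  { intros x [h h']. apply hseg'. revert h h'.
    unfold Rmin, Rmax. destruct Rle_dec; lra. }
  assert (hiff : forall a b, M < a ->
    quantization_eq V beta delta sigma a b <-> phase P Q l r a b = 0).
  { intros a b ha.
    unfold l, r; rewrite <- phase_segment
      by (intros x; apply (continuous_phase_integrand P Q M); auto).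
    apply sqrt_branch_phase; auto.
    - intros x. pose proof (hPM x) as h; apply Rabs_le_between in h; lra.
    - intros x hx. unfold P, Q, I. rewrite clamp_id by auto.
      destruct (V (RtoC x)) as [vr vi].
      unfold Cminus, Cplus, Copp, Cmult, Ci, RtoC; simpl.
      f_equal; ring. }
  (* The value [0] for [a <= M + 1] is a placeholder: both claims concern large [a] only. *)
  exists (fun a => match Rlt_dec (M + 1) a with
    | left ha => proj1_sig
        (phase_root_exists P Q l r M hlr hM hPc hQc hPM hQM a ha)
    | right _ => 0 end).
  assert (hroot : forall a, M + 1 < a -> phase P Q l r a
    match Rlt_dec (M + 1) a with
    | left ha => proj1_sig
        (phase_root_exists P Q l r M hlr hM hPc hQc hPM hQM a ha)
    | right _ => 0 end = 0).
  { intros a ha. destruct (Rlt_dec (M + 1) a) as [h | h]; [|contradiction].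
    apply (proj2_sig (phase_root_exists P Q l r M hlr hM hPc hQc hPM hQM a h)). }
  split.
  - exists (M + 1); intros a ha.
    split.
    + apply hiff; [lra|]. apply hroot, ha.
    + intros b hb. apply hiff in hb; [|lra].
      apply (phase_root_unique P Q l r M) with (a := a); auto; lra.
  (* Constant and threshold are those of [phase_root_asymp]; the threshold exceeds [M + 1], so the
     chosen value is a true root. *)
  - exists (8 * (M * M * M)), (2 * M + 2); intros a ha.
    replace (1 / (beta - sigma) * Im (Y beta - Y sigma)%C + sigma * delta)
      with (RInt Q l r / (r - l)).
    { apply (phase_root_asymp P Q l r M); auto using Rlt_le; apply hroot; lra. }
    assert (hend : segment (-1) 1 l /\ segment (-1) 1 r).
    { unfold l, r; split; apply hsub; split;
        auto using Rmin_Rmax, Rle_refl. }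
    (* The leading term is the mean of [Q]: its part [Im V] integrates to the increment of [Im Y],
       and the constant [sigma * delta] to [(r - l)] times itself. *)
    assert (hQI : RInt Q l r = Im (Y r) - Im (Y l) + (r - l) * (sigma * delta)).
    { rewrite <- (RInt_Im_derive (-1) 1 l r Y (fun x => V (RtoC x)));
        [|assumption..|apply hend|apply hend].
      apply is_RInt_unique.
      apply (is_RInt_plus (V := R_NormedModule)).
      - apply (RInt_correct (V := R_CompleteNormedModule)).
        apply (ex_RInt_continuous (V := R_CompleteNormedModule)).
        intros x _; apply hIc.
      - apply (is_RInt_const (V := R_NormedModule)). }
    rewrite hQI. unfold l, r.
    change (Im (Y beta - Y sigma)%C) with (Im (Y beta) - Im (Y sigma)).
    (* The difference quotient of [Im Y] is unchanged when its two end points are exchanged, so both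
       orders give the same leading term. *)
    destruct (Rle_lt_dec sigma beta) as [h | h].
    + rewrite Rmin_left, Rmax_right by exact h. field; lra.
    + rewrite Rmin_right, Rmax_left by lra. field; lra.
Qed.
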